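(* Let $g=4k-1$ or $g=4k+1$ with $k\ge1$, and let $\overline{M_m}$, $0\le m\le\frac{g+1}{2}$, be the matrices defined in the context, regarded as spin structures of $\Sigma_g$. (1) For $1\le m\le \frac{g+1}{2}$, the group $$\mathfrak{G}_m:=\langle \sigma_i \mid 1\le i\le 2g+1,\ i\ne g+1+2m\rangle\cong \mathfrak{S}_{g+1+2m}\times\mathfrak{S}_{g+1-2m}$$ is a subgroup of the isotropy group at $\overline{M_m}$ for the $\mathfrak{S}_{2g+2}$ action (here $\mathfrak{S}_0$ is trivial). (2) The group $$\mathfrak{G}_0:=\langle \sigma_i,\tau \mid 1\le i\le 2g+1,\ i\ne g+1\rangle$$ is a subgroup of the isotropy group at $\overline{M_0}$, where $\tau$ is the product of the transpositions $(i,2g+3-i)$, $1\le i\le g+1$, i.e. $\tau=(1,2g+2)(2,2g+1)(3,2g)\cdots(g+1,g+2)$.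
   Context: $\Sigma_g$ is a compact connected oriented surface of genus $g$, and $\alpha_1,\dots,\alpha_g,\beta_1,\dots,\beta_g$ is a symplectic basis of $H_1(\Sigma_g,\mathbb{Z}/2)$, i.e. $\alpha_i\cdot\beta_j=\delta_{ij}$, $\alpha_i\cdot\alpha_j=\beta_i\cdot\beta_j=0$ for the mod 2 intersection number. A spin structure is a map $c:H_1(\Sigma_g,\mathbb{Z}/2)\to\mathbb{Z}/2$ with $c(x+y)=c(x)+c(y)+x\cdot y$ for all $x,y$; $\mathcal{C}$ is the set of spin structures. The corresponding matrix of $c$ is the $2\times g$ matrix $M$ over $\mathbb{Z}/2$ whose $i$-th column is $\begin{pmatrix}c(\alpha_i)\\c(\beta_i)\end{pmatrix}$; it determines $c$, every $2\times g$ matrix over $\mathbb{Z}/2$ arises, and spin structures are identified with their matrices. For $\gamma\in H_1(\Sigma_g,\mathbb{Z}/2)$ let $T_\gamma(x)=x+(x\cdot\gamma)\gamma$, an element of the group $Sp_{2g}(\mathbb{Z}/2)$ of automorphisms preserving the intersection number. Let $\sigma_i=(i,i+1)\in\mathfrak{S}_{2g+2}$, $1\le i\le 2g+1$, where $\mathfrak{S}_n$ is the symmetric group. The group $\mathfrak{S}_{2g+2}$ acts through the homomorphism $\iota:\mathfrak{S}_{2g+2}\to Sp_{2g}(\mathbb{Z}/2)$ determined by $\iota(\sigma_1)=T_{\beta_1}$, $\iota(\sigma_{2g+1})=T_{\beta_g}$, $\iota(\sigma_{2i})=T_{\alpha_i}$ ($1\le i\le g$), $\iota(\sigma_{2j+1})=T_{\beta_j+\beta_{j+1}}$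 ($1\le j\le g-1$). It acts on $\mathcal{C}$ from the right by $c\circ\sigma:=c\circ\iota(\sigma)$. The isotropy group at $c$ is $\{\sigma\in\mathfrak{S}_{2g+2}: c\circ\sigma=c\}$. For $i\ge1$, $A_i$ is the $2\times(2i-1)$ matrix over $\mathbb{Z}/2$ whose odd-numbered columns are $\begin{pmatrix}1\\1\end{pmatrix}$ and whose even-numbered columns are $\begin{pmatrix}1\\0\end{pmatrix}$. The $2\times g$ matrices $\overline{M_m}$ are defined by horizontal concatenation of blocks: Case $g=4k-1$ ($0\le m\le 2k$): $\overline{M_{2i}}=\begin{pmatrix}A_{k+i}&\begin{matrix}0\\0\end{matrix}&A_{k-i}\end{pmatrix}$ for $0\le i\le k-1$; $\overline{M_{2i+1}}=\begin{pmatrix}A_{k+i}&\begin{matrix}1&0&1\\0&1&0\end{matrix}&A_{k-i-1}\end{pmatrix}$ for $0\le i\le k-2$; $\overline{M_{2k-1}}=\begin{pmatrix}A_{2k-1}&\begin{matrix}1&0\\0&1\end{matrix}\end{pmatrix}$; $\overline{M_{2k}}=A_{2k}$. Case $g=4k+1$ ($0\le m\le 2k+1$): $\overline{M_{2i}}=\begin{pmatrix}A_{k+i}&\begin{matrix}1&0&1\\0&1&0\end{matrix}&A_{k-i}\end{pmatrix}$ for $0\le i\le k-1$; $\overline{M_{2i+1}}=\begin{pmatrix}A_{k+i+1}&\begin{matrix}0\\0\end{matrix}&A_{k-i}\end{pmatrix}$ for $0\le i\le k-1$; $\overline{M_{2k}}=\begin{pmatrix}A_{2k}&\begin{matrix}1&0\\0&1\end{matrix}\end{pmatrix}$;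 $\overline{M_{2k+1}}=A_{2k+1}$. The paper denotes the group $\langle \sigma_i,\tau \mid i\ne g+1\rangle$ by $\mathfrak{S}_{g+1}\overleftrightarrow{\times}\mathfrak{S}_{g+1}$. *)

(* Defs.v *)
From HB Require Import structures.
From mathcomp Require Import all_boot all_order all_algebra all_fingroup.
From mathcomp Require Import zify.

Set Implicit Arguments.
Unset Strict Implicit.
Unset Printing Implicit Defensive.

Import GRing.Theory.

Local Open Scope ring_scope.

(* H_1(Sigma_g, Z/2), identified with (Z/2)^(2g) by an arbitrary choice of
   coordinates: neither the intersection form nor the symplectic basis below
   is assumed to be the standard one. *)
Notation H1 g := 'rV['F_2]_(g + g).

Section Surface.

Variable g : nat.
Implicit Types (dot : {biscalar H1 g}) (alpha beta : 'I_g -> H1 g).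

(* Indices are shifted: alpha i and beta i, 0 <= i < g, stand for
   alpha_(i+1) and beta_(i+1). *)
Record symplectic_basis dot alpha beta : Prop := SymplecticBasis {
  dot_alternating : forall x, dot x x = 0;
  alpha_beta_basis : basis_of fullv (codom alpha ++ codom beta);
  dot_alpha_beta : forall i j, dot (alpha i) (beta j) = (i == j)%:R;
  dot_alpha_alpha : forall i j, dot (alpha i) (alpha j) = 0;
  dot_beta_beta : forall i j, dot (beta i) (beta j) = 0
}.

Definition spin_structure dot (c : {ffun H1 g -> 'F_2}) : Prop :=
  forall x y, c (x + y) = c x + c y + dot x y.

Definition spin_matrix alpha beta (c : {ffun H1 g -> 'F_2}) : 'M['F_2]_(2, g) :=
  \matrix_(r < 2, i < g) (if r == 0 then c (alpha i) else c (beta i)).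

(* Over 'F_2, linear is the same as additive. *)
Definition Sp dot : {set {perm H1 g}} :=
  [set f : {perm H1 g} | [forall x, forall y, (f (x + y) == f x + f y)
                                && (dot (f x) (f y) == dot x y)]].

Definition transvection dot (gamma x : H1 g) : H1 g :=
  x + dot x gamma *: gamma.

(* The points 1, ..., 2g+2 are the elements 0, ..., 2g+1 of 'I_(2g+2), while
   the index i of sigma ranges over 1, ..., 2g+1. *)
Definition sigma (i : nat) : 'S_(2 * g).+2 := tperm (inord i.-1) (inord i).

Definition tau : 'S_(2 * g).+2 :=
  (\prod_(1 <= i < g.+2) tperm (inord i.-1) (inord (2 * g + 3 - i).-1))%g.

(* The product s * t in {perm T} is "s, then t", both in the source and in the
   target, so that a morphism is one for the usual composition of maps as
   well. *)
Record is_iota dot alpha beta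
    (iota : {morphism [set: 'S_(2 * g).+2] >-> {perm H1 g}}) : Prop := IsIota {
  iota_Sp : (iota @* [set: 'S_(2 * g).+2] \subset Sp dot)%g;
  iota_first : forall i : 'I_g, i = 0%N :> nat ->
    iota (sigma 1) =1 transvection dot (beta i);
  iota_last : forall i : 'I_g, i.+1 = g ->
    iota (sigma (2 * g + 1)) =1 transvection dot (beta i);
  iota_even : forall i : 'I_g,
    iota (sigma (2 * i.+1)) =1 transvection dot (alpha i);
  iota_odd : forall i j : 'I_g, j = i.+1 :> nat ->
    iota (sigma (2 * i.+1 + 1)) =1 transvection dot (beta i + beta j)
}.

Definition spin_act (iota : {morphism [set: 'S_(2 * g).+2] >-> {perm H1 g}})
    (c : {ffun H1 g -> 'F_2}) (s : 'S_(2 * g).+2) : {ffun H1 g -> 'F_2} :=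
  [ffun x => c (iota s x)].

Definition isotropy (iota : {morphism [set: 'S_(2 * g).+2] >-> {perm H1 g}})
    (c : {ffun H1 g -> 'F_2}) : {set 'S_(2 * g).+2} :=
  [set s | spin_act iota c s == c].

Definition sigmas_but (p : nat) : {set 'S_(2 * g).+2} :=
  [set sigma i | i : 'I_(2 * g).+2 & (0 < i)%N && (i != p :> nat)].

Definition GG (m : nat) : {group 'S_(2 * g).+2} :=
  <<sigmas_but (g + 1 + 2 * m)>>%G.

Definition GG0 : {group 'S_(2 * g).+2} :=
  <<tau |: sigmas_but (g + 1)>>%G.

End Surface.

(* A 2 x n block is given by the sequence of its n columns (top, bottom), so
   that horizontal concatenation is ++. *)
Definition block := seq ('F_2 * 'F_2).

(* Position j (from 0) is column number j + 1. *)
Definition A (i : nat) : block :=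
  mkseq (fun j => if odd j then (1, 0) else (1, 1)) (2 * i - 1).

Definition zero_block : block := [:: (0, 0)].
Definition mid_block : block := [:: (1, 0); (0, 1); (1, 0)].
Definition end_block : block := [:: (1, 0); (0, 1)].

(* g = 4k - 1, 0 <= m <= 2k *)
Definition Mbar_blocks_m1 (k m : nat) : block :=
  let i := m./2 in
  if m == (2 * k)%N then A (2 * k)
  else if m == (2 * k - 1)%N then A (2 * k - 1) ++ end_block
  else if odd m then A (k + i) ++ mid_block ++ A (k - i - 1)
  else A (k + i) ++ zero_block ++ A (k - i).

(* g = 4k + 1, 0 <= m <= 2k + 1 *)
Definition Mbar_blocks_p1 (k m : nat) : block :=
  let i := m./2 in
  if m == (2 * k + 1)%N then A (2 * k + 1)
  else if m == (2 * k)%N then A (2 * k) ++ end_block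
  else if odd m then A (k + i + 1) ++ zero_block ++ A (k - i)
  else A (k + i) ++ mid_block ++ A (k - i).

Definition matrix_of_block (g : nat) (b : block) : 'M['F_2]_(2, g) :=
  \matrix_(r < 2, j < g)
    (if r == 0 then (nth (0, 0) b j).1 else (nth (0, 0) b j).2).

Definition Mbar (k g m : nat) : 'M['F_2]_(2, g) :=
  matrix_of_block g
    (if g == (4 * k + 1)%N then Mbar_blocks_p1 k m else Mbar_blocks_m1 k m).

(* The blocks have total width g, so matrix_of_block neither pads nor cuts. *)
Lemma size_Mbar_blocks_m1 k m : (0 < k)%N -> (m <= 2 * k)%N ->
  size (Mbar_blocks_m1 k m) = (4 * k - 1)%N.
Proof.
move=> k0 mk; have := odd_double_half m; rewrite /Mbar_blocks_m1 /A.
case: eqP => [-> _|m1]; first by rewrite size_mkseq; lia.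
case: eqP => [-> _|m2]; first by rewrite size_cat size_mkseq /=; lia.
by case: (odd m); rewrite /= !size_cat /= !size_mkseq; lia.
Qed.

Lemma size_Mbar_blocks_p1 k m : (0 < k)%N -> (m <= 2 * k + 1)%N ->
  size (Mbar_blocks_p1 k m) = (4 * k + 1)%N.
Proof.
move=> k0 mk; have := odd_double_half m; rewrite /Mbar_blocks_p1 /A.
case: eqP => [-> _|m1]; first by rewrite size_mkseq; lia.
case: eqP => [-> _|m2]; first by rewrite size_cat size_mkseq /=; lia.
by case: (odd m); rewrite /= !size_cat /= !size_mkseq; lia.
Qed.

(* Main.v *)
(* A spin structure c satisfies c o T_gamma = c as soon as c(gamma) = 1.  Let
   gamma_n be the vector of the transvection iota(sigma_n).  All the matrices
   Mbar_m have the same shape: c(beta_i) = 1 exactly for i odd, and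
   c(alpha_i) = 1 except for i = (g+1)/2 + m; hence c(gamma_n) = 1 except for
   n = g+1+2m.  For tau, conjugation exchanges sigma_n and sigma_(2g+2-n), and a
   transvection over F_2 determines its vector, so iota(tau) exchanges gamma_n
   and gamma_(2g+2-n); thus c and c o iota(tau) agree on the gamma_n, which span
   H_1, and both being quadratic for the same form they are equal. *)
Require Import Defs.
From mathcomp Require Import all_boot all_order all_algebra all_fingroup.
From mathcomp Require Import zify.

Set Implicit Arguments.
Unset Strict Implicit.
Unset Printing Implicit Defensive.

Import GRing.Theory.

Local Open Scope ring_scope.

(** * Pairs of permutations acting on a disjoint union *)

Section SumPerm.

Variables (A B T : finType) (h : A + B -> T) (h' : T -> A + B).
Hypotheses (hK : cancel h h') (h'K : cancel h' h).

(** The bijection [h] is left arbitrary so that the points of ['I_(2 * g).+2] can be cut at any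
    place. *)
Definition sum_perm_fun (st : {perm A} * {perm B}) (x : T) : T :=
  h (match h' x with inl i => inl (st.1 i) | inr j => inr (st.2 j) end).

Lemma sum_perm_fun_inj st : injective (sum_perm_fun st).
Proof.
move=> x y /(can_inj hK) E; apply: (can_inj h'K).
by case: (h' x) (h' y) E => [i|i] [j|j] // [] /perm_inj ->.
Qed.

Definition sum_perm st : {perm T} := perm (@sum_perm_fun_inj st).

Lemma sum_perm_inl st i : sum_perm st (h (inl i)) = h (inl (st.1 i)).
Proof. by rewrite permE /sum_perm_fun hK. Qed.

Lemma sum_perm_inr st j : sum_perm st (h (inr j)) = h (inr (st.2 j)).
Proof. by rewrite permE /sum_perm_fun hK. Qed.

Lemma sum_permM : {in setX [set: {perm A}] [set: {perm B}] &,
  {morph sum_perm : x y / (x * y)%g}}.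
Proof.
move=> st st' _ _; apply/permP=> x; rewrite -(h'K x) permM.
by case: (h' x) => i; rewrite !(sum_perm_inl, sum_perm_inr) /= permM.
Qed.

Canonical sum_perm_morphism := Morphism sum_permM.

Lemma injm_sum_perm : ('injm sum_perm)%g.
Proof.
apply/injmP=> -[s t] [s' t'] _ _ E; congr pair; apply/permP=> i.
  have := congr1 (fun u : {perm T} => u (h (inl i))) E.
  by rewrite !sum_perm_inl => /(can_inj hK) [].
have := congr1 (fun u : {perm T} => u (h (inr i))) E.
by rewrite !sum_perm_inr => /(can_inj hK) [].
Qed.

Lemma sum_perm_tperm_inl i j :
  sum_perm (tperm i j, 1%g) = tperm (h (inl i)) (h (inl j)).
Proof.
apply/permP=> x; rewrite -(h'K x); case: (h' x) => z.
  rewrite sum_perm_inl /=.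
  have I : injective (h \o inl) by apply: inj_comp (can_inj hK) _ => u v [].
  exact: (inj_tperm _ _ _ I).
by rewrite sum_perm_inr perm1 tpermD // (can_eq hK).
Qed.

Lemma sum_perm_tperm_inr i j :
  sum_perm (1%g, tperm i j) = tperm (h (inr i)) (h (inr j)).
Proof.
apply/permP=> x; rewrite -(h'K x); case: (h' x) => z.
  by rewrite sum_perm_inl perm1 tpermD // (can_eq hK).
rewrite sum_perm_inr /=.
have I : injective (h \o inr) by apply: inj_comp (can_inj hK) _ => u v [].
exact: (inj_tperm _ _ _ I).
Qed.

(** Since [(s, t)] factors as [(s, 1) * (1, t)] and transpositions generate each factor, it suffices
    to have the transpositions inside each summand. *)
Lemma sum_perm_sub (G : {group {perm T}}) :
  (forall i j, tperm (h (inl i)) (h (inl j)) \in G) ->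
  (forall i j, tperm (h (inr i)) (h (inr j)) \in G) ->
  (sum_perm @* setX [set: {perm A}] [set: {perm B}] \subset G)%g.
Proof.
move=> Gl Gr; apply/subsetP=> _ /morphimP [[s t] _ _ ->] /=.
have Ml x y : sum_perm (x * y, 1)%g = (sum_perm (x, 1) * sum_perm (y, 1))%g.
  by rewrite -sum_permM ?inE //; congr sum_perm; congr pair; rewrite /= mulg1.
have Mr x y : sum_perm (1, x * y)%g = (sum_perm (1, x) * sum_perm (1, y))%g.
  by rewrite -sum_permM ?inE //; congr sum_perm; congr pair; rewrite /= mulg1.
have -> : sum_perm (s, t) = (sum_perm (s, 1) * sum_perm (1, t))%g.
  rewrite -sum_permM ?inE //; congr sum_perm.
  by congr pair; rewrite /= ?mulg1 ?mul1g.
rewrite groupM //.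
  have [ts -> _] := prod_tpermP s; elim: ts => [|[i j] ts IH].
    by rewrite big_nil [sum_perm _]morph1.
  by rewrite big_cons Ml groupM // sum_perm_tperm_inl.
have [ts -> _] := prod_tpermP t; elim: ts => [|[i j] ts IH].
  by rewrite big_nil [sum_perm _]morph1.
by rewrite big_cons Mr groupM // sum_perm_tperm_inr.
Qed.

End SumPerm.

(** * The group generated by all [sigma] but one, and the reversal [tau] *)

Section YoungSubgroup.

Variable g : nat.
Local Notation N := (2 * g).+2.

Lemma sigma_in_gen p i : (0 < i < N)%N -> i != p ->
  sigma g i \in <<sigmas_but g p>>%g.
Proof.
move=> /andP[i0 iN] ip; apply: mem_gen; apply/imsetP.
by exists (Ordinal iN); rewrite ?inE //= i0.
Qed.

(** Conjugating [(i j)] by [sigma j.+1] gives [(i j+1)]. Points count from 0, so [sigma p] joins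
    [p - 1] to [p], and the second hypothesis says that this cut is not crossed. *)
Lemma tperm_in_gen p i j : (i < j < N)%N -> ~~ (i < p <= j)%N ->
  tperm (inord i) (inord j) \in <<sigmas_but g p>>%g.
Proof.
elim: j => [|j IH] // /andP[ij jN] ipj.
have Sj : sigma g j.+1 \in <<sigmas_but g p>>%g.
  by apply: sigma_in_gen; [lia|apply: contraNneq ipj => <-; lia].
have [-> //|ne] := eqVneq i j.
have -> : tperm (inord i) (inord j.+1) =
    (tperm (inord i) (inord j) ^ sigma g j.+1)%g :> 'S_N.
  rewrite tpermJ /sigma /= tpermL tpermD // -val_eqE /= !inordK; lia.
by rewrite groupJ // IH; lia.
Qed.

(** The image of the product under the injective [sum_perm] is the generated subgroup. When [b = 0],
    the index [a] is out of range and no generator is omitted. *)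
Lemma GG_isog a b : (a + b)%N = N ->
  (<<sigmas_but g a>> \isog setX [set: 'S_a] [set: 'S_b])%g.
Proof.
move=> e.
pose h (u : 'I_a + 'I_b) : 'I_N := cast_ord e (unsplit u).
pose h' (x : 'I_N) : 'I_a + 'I_b := split (cast_ord (esym e) x).
have hK : cancel h h' by move=> u; rewrite /h /h' cast_ordK unsplitK.
have h'K : cancel h' h by move=> x; rewrite /h /h' splitK cast_ordKV.
have hl i : h (inl i) = inord i.
  by apply/val_inj; rewrite /= inordK //; have := ltn_ord i; lia.
have hr j : h (inr j) = inord (a + j).
  by apply/val_inj; rewrite /= inordK //; have := ltn_ord j; lia.
suff <- : (sum_perm hK h'K @* setX [set: 'S_a] [set: 'S_b] =
    <<sigmas_but g a>>)%g.
  rewrite isog_sym; exact: sub_isog (injm_sum_perm hK h'K).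
have tperm_gen (i j : nat) : (i < N)%N -> (j < N)%N -> (i < a)%N = (j < a)%N ->
    tperm (inord i) (inord j) \in <<sigmas_but g a>>%g.
  move=> iN jN ija; have [ij|ij|->] := ltngtP i j; last by rewrite tperm1 group1.
    by apply: tperm_in_gen; lia.
  by rewrite tpermC; apply: tperm_in_gen; lia.
apply/eqP; rewrite eqEsubset; apply/andP; split.
  apply: sum_perm_sub => i j; rewrite !(hl, hr).
    by apply: tperm_gen; have := ltn_ord i; have := ltn_ord j; lia.
  by apply: tperm_gen; have := ltn_ord i; have := ltn_ord j; lia.
rewrite gen_subG; apply/subsetP=> s /imsetP[i]; rewrite inE => /andP[i0 ia] ->.
(* As [i] differs from [a], the points [i - 1] and [i] lie on the same side of the cut. *)
have [ltia|ltai] : (i < a \/ a < i)%N by lia.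
  have ltia' : (i.-1 < a)%N by lia.
  rewrite /sigma -[inord i.-1]/(inord (Ordinal ltia')) 
   -[inord i]/(inord (Ordinal ltia)).
  by rewrite -!hl -(sum_perm_tperm_inl hK h'K) mem_morphim ?inE.
have ib : (i - a < b)%N by have := ltn_ord i; lia.
have ib' : (i.-1 - a < b)%N by have := ltn_ord i; lia.
rewrite /sigma.
have -> : inord i = inord (a + Ordinal ib) :> 'I_N by congr inord => /=; lia.
have -> : inord i.-1 = inord (a + Ordinal ib') :> 'I_N.
  by congr inord => /=; lia.
by rewrite -!hr -(sum_perm_tperm_inr hK h'K) mem_morphim ?inE.
Qed.

Lemma val_tau (x : 'I_N) : tau g x = rev_ord x.
Proof.
(* The first [n] transpositions reverse the [n] outermost points at each end and fix the middle,
   which is empty for [n = g + 1]. *)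
suff H n : (n <= g.+1)%N ->
    ((\prod_(1 <= i < n.+1)
        tperm (inord i.-1) (inord (2 * g + 3 - i).-1))%g : 'S_N) x =
    if (n <= x < N - n)%N then x else rev_ord x.
  by rewrite /tau H //; case: ifP => //; lia.
elim: n => [|n IH] nle; first by rewrite big_geq // perm1 subn0 ltn_ord.
rewrite big_nat_recr //= permM IH; last lia.
have xN := ltn_ord x.
have [n1 n2] : (n < N /\ (2 * g + 3 - n.+1).-1 < N)%N by lia.
have val_if (c : bool) (y z : 'I_N) :
  val (if c then y else z) = if c then val y else val z by case: c.
apply/val_inj; case: tpermP => [/(congr1 val)|/(congr1 val)|/eqP + /eqP];
  rewrite -?val_eqE !val_if /= !inordK //; do 2!case: ifP; lia.
Qed.

Lemma sigmaJ_tau i : (0 < i < N)%N -> (sigma g i ^ tau g)%g = sigma g (N - i).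
Proof.
move=> iN; rewrite tpermJ !val_tau tpermC /sigma.
by congr tperm; apply/val_inj; rewrite /= !inordK; lia.
Qed.

End YoungSubgroup.

(** * One formula for the columns of all the matrices *)

Section StandardColumns.

(* Every [Mbar] has top entries 1 except in column p = (g+1)/2 + m, and bottom
   entries 1, 0, 1, 0, ..., 1. *)
Definition std_col (p j : nat) : 'F_2 * 'F_2 := ((j.+1 != p)%:R, (~~ odd j)%:R).

Definition std_block p o n : block := map (std_col p) (iota o n).

Lemma std_block_cat p o n n' :
  std_block p o n ++ std_block p (o + n) n' = std_block p o (n + n').
Proof. by rewrite /std_block iotaD map_cat. Qed.

(** An even offset preserves the parity pattern. Offsets count from 0 and [p] from 1, so the two
    alternatives put the exceptional column strictly before or after the block. *)
Lemma A_std p o n : ~~ odd o -> (p <= o \/ o + (2 * n - 1) < p)%N ->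
  A n = std_block p o (2 * n - 1).
Proof.
move=> oo po; rewrite /std_block.
apply: (@eq_from_nth _ (0, 0)); first by rewrite /A /mkseq !size_map !size_iota.
move=> j; rewrite size_mkseq => jn.
rewrite nth_mkseq // (nth_map 0%N) ?size_iota // nth_iota //.
rewrite /std_col oddD (negbTE oo) /=.
have -> : ((o + j).+1 != p) by lia.
by case: odd.
Qed.

(** The exceptional column is [(0, 0)] at an odd position, as here, and [(0, 1)] at an even one, as
    in [end_block] and [mid_block]. *)
Lemma zero_std p o : odd o -> p = o.+1 -> zero_block = std_block p o 1.
Proof. by move=> oo ->; rewrite /std_block /= /std_col eqxx oo. Qed.

Lemma end_std p o : odd o -> p = o.+2 -> end_block = std_block p o 2.
Proof.
by move=> oo ->; rewrite /std_block /= /std_col eqxx /= oo /= (ltn_eqF (ltnSn _)).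
Qed.

Lemma mid_std p o : odd o -> p = o.+2 -> mid_block = std_block p o 3.
Proof.
move=> oo ->; rewrite /std_block /= /std_col eqxx /= oo /=.
by rewrite (ltn_eqF (ltnSn _)) (gtn_eqF (ltnSn _)).
Qed.

Lemma Mbar_blocks_m1E k m : (0 < k)%N -> (m <= 2 * k)%N ->
  Mbar_blocks_m1 k m = std_block (2 * k + m) 0 (4 * k - 1).
Proof.
move=> k0 mk; have := odd_double_half m; rewrite /Mbar_blocks_m1; set i := m./2.
(* For [m = 2k] the exceptional column [4k] lies just beyond the last one, so a single [A] block
   remains. *)
case: eqP => [-> _|m1].
  by rewrite (@A_std (2 * k + 2 * k) 0) //; [congr std_block|]; lia.
case: eqP => [-> _|m2].
  rewrite (@A_std (2 * k + (2 * k - 1)) 0) //; last lia.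
  rewrite (@end_std (2 * k + (2 * k - 1)) (0 + (2 * (2 * k - 1) - 1))); try lia.
  by rewrite std_block_cat; congr std_block; lia.
case: (odd m) => mi.
  rewrite (@A_std (2 * k + m) 0 (k + i)) //; last lia.
  rewrite (@mid_std (2 * k + m) (0 + (2 * (k + i) - 1))); try lia.
  rewrite (@A_std (2 * k + m) (0 + (2 * (k + i) - 1 + 3))); try lia.
  by rewrite catA !std_block_cat; congr std_block; lia.
rewrite (@A_std (2 * k + m) 0 (k + i)) //; last lia.
rewrite (@zero_std (2 * k + m) (0 + (2 * (k + i) - 1))); try lia.
rewrite (@A_std (2 * k + m) (0 + (2 * (k + i) - 1 + 1))); try lia.
by rewrite catA !std_block_cat; congr std_block; lia.
Qed.

Lemma Mbar_blocks_p1E k m : (0 < k)%N -> (m <= 2 * k + 1)%N ->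
  Mbar_blocks_p1 k m = std_block (2 * k + 1 + m) 0 (4 * k + 1).
Proof.
move=> k0 mk; have := odd_double_half m; rewrite /Mbar_blocks_p1; set i := m./2.
set p := (2 * k + 1 + m)%N.
case: eqP => [m1 _|m1]; first by rewrite (@A_std p 0) //; [congr std_block|]; lia.
case: eqP => [m2 _|m2].
  rewrite (@A_std p 0) //; last lia.
  rewrite (@end_std p (0 + (2 * (2 * k) - 1))); try lia.
  by rewrite std_block_cat; congr std_block; lia.
case: (odd m) => mi.
  rewrite (@A_std p 0 (k + i + 1)) //; last lia.
  rewrite (@zero_std p (0 + (2 * (k + i + 1) - 1))); try lia.
  rewrite (@A_std p (0 + (2 * (k + i + 1) - 1 + 1))); try lia.
  by rewrite catA !std_block_cat; congr std_block; lia.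
rewrite (@A_std p 0 (k + i)) //; last lia.
rewrite (@mid_std p (0 + (2 * (k + i) - 1))); try lia.
rewrite (@A_std p (0 + (2 * (k + i) - 1 + 3))); try lia.
by rewrite catA !std_block_cat; congr std_block; lia.
Qed.

Lemma MbarE k g m (j : 'I_g) : (0 < k)%N ->
  g = (4 * k - 1)%N \/ g = (4 * k + 1)%N -> (m <= (g + 1) %/ 2)%N ->
  (Mbar k g m 0 j = (j.+1 != (g + 1) %/ 2 + m)%N%:R) *
  (Mbar k g m 1 j = (~~ odd j)%:R).
Proof.
move=> k0 gE mg; rewrite /Mbar !mxE /=.
suff -> : (if g == (4 * k + 1)%N then Mbar_blocks_p1 k m
           else Mbar_blocks_m1 k m) = std_block ((g + 1) %/ 2 + m) 0 g.
  by rewrite (nth_map 0%N) ?size_iota // nth_iota.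
case: eqP => gk.
  by rewrite Mbar_blocks_p1E; [congr std_block | |]; lia.
by rewrite Mbar_blocks_m1E; [congr std_block | |]; lia.
Qed.

End StandardColumns.

(** * Spin structures as quadratic forms, and the transvection vectors *)

Section SpinStructures.

Variables (g : nat) (dot : {biscalar H1 g}) (alpha beta : 'I_g -> H1 g).
Hypothesis symp : symplectic_basis dot alpha beta.
Implicit Types (x y : H1 g) (c : {ffun H1 g -> 'F_2}).

Lemma addF2 (a : 'F_2) : a + a = 0.
Proof. exact: addrr_pchar2 (pchar_Fp (isT : prime 2)) a. Qed.

Lemma F2_cases (a : 'F_2) : a = 0 \/ a = 1.
Proof. by case: a => [[|[|]]] // ?; [left|right]; apply/val_inj. Qed.

Lemma addF2_eq0 (a b : 'F_2) : a + b = 0 -> a = b.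
Proof. by move=> ab; rewrite -[a]addr0 -(addF2 b) addrA ab add0r. Qed.

Lemma dot_sym x y : dot x y = dot y x.
Proof.
apply: addF2_eq0; have := dot_alternating symp (x + y).
by rewrite linearDl !linearDr /= !(dot_alternating symp) add0r addr0.
Qed.

Lemma spin0 c : spin_structure dot c -> c 0 = 0.
Proof.
by move=> /(_ 0 0); rewrite addr0 addF2 add0r (dot_alternating symp).
Qed.

(** If [dot x gamma = 1], the added terms [c gamma] and [dot x gamma] are both 1 and cancel. *)
Lemma spin_transvection c gamma x : spin_structure dot c -> c gamma = 1 ->
  c (transvection dot gamma x) = c x.
Proof.
move=> cP c1; rewrite /transvection cP linearZr_LR /=.
have [->|->] := F2_cases (dot x gamma).
  by rewrite scale0r (spin0 cP) mul0r !addr0.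
by rewrite scale1r c1 mul1r -addrA addF2 addr0.
Qed.

(* [betaN] and [alphaN] are numbered from 1, as in the paper, and vanish at 0 and
   beyond g, so that [gammaN n] below is uniformly the vector of the transvection
   [iota (sigma n)], including n = 1 and n = 2g+1. *)
Definition betaN (n : nat) : H1 g :=
  if n is n'.+1 then oapp beta 0 (insub n') else 0.

Definition alphaN (n : nat) : H1 g :=
  if n is n'.+1 then oapp alpha 0 (insub n') else 0.

Definition gammaN (n : nat) : H1 g :=
  if odd n then betaN n./2 + betaN n./2.+1 else alphaN n./2.

Lemma betaN_ord (i : 'I_g) : betaN i.+1 = beta i.
Proof. by rewrite /= valK. Qed.

Lemma alphaN_ord (i : 'I_g) : alphaN i.+1 = alpha i.
Proof. by rewrite /= valK. Qed.

Lemma betaN_big : betaN g.+1 = 0.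
Proof. by rewrite /= insubF ?ltnn. Qed.

Lemma gammaN_even n : gammaN (2 * n) = alphaN n.
Proof. by rewrite /gammaN mul2n odd_double doubleK. Qed.

Lemma gammaN_odd n : gammaN (2 * n).+1 = betaN n + betaN n.+1.
Proof. by rewrite /gammaN mul2n /= odd_double /= uphalf_double. Qed.

(** Such an [x] is moved by the transvection, which makes it possible to recover the vector from the
    map. *)
Lemma dot_gammaN n : (0 < n < (2 * g).+2)%N -> (0 < g)%N ->
  exists x, dot x (gammaN n) = 1.
Proof.
move=> nP g0; have := odd_double_half n; case: (odd n) => nE.
  have {nE} -> : n = (2 * n./2).+1 by lia.
  rewrite gammaN_odd; set m := n./2; have [mg|mg] := ltnP m g.
    (* Counting from 1, this is the dual of the second summand, [betaN m.+1], and it is orthogonal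
       to the first. *)
    exists (alpha (Ordinal mg)); rewrite (betaN_ord (Ordinal mg)) linearDr /=.
    rewrite (dot_alpha_beta symp) eqxx; case: m mg {nP} => [|m] mg.
      by rewrite linear0r add0r.
    have mg' : (m < g)%N by lia.
    rewrite (betaN_ord (Ordinal mg')) (dot_alpha_beta symp).
    by rewrite -val_eqE /= (gtn_eqF (ltnSn _)) add0r.
  (* Now [m = g]: the second summand vanishes and the dual of the last [beta] serves. *)
  have {mg nP} mg : m = g.-1.+1 by lia.
  have g1 : (g.-1 < g)%N by lia.
  exists (alpha (Ordinal g1)).
  rewrite [in betaN m]mg (betaN_ord (Ordinal g1)) mg prednK // betaN_big addr0.
  by rewrite (dot_alpha_beta symp) eqxx.
have {nE} -> : n = (2 * n./2.-1.+1)%N by lia.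
have ng : (n./2.-1 < g)%N by lia.
exists (beta (Ordinal ng)); rewrite gammaN_even (alphaN_ord (Ordinal ng)).
by rewrite dot_sym (dot_alpha_beta symp) eqxx.
Qed.

(** The polar terms cancel in the sum [d] of the two structures, so [d] is linear and it suffices
    that it vanish on the symplectic basis. *)
Lemma spin_ext c c' : spin_structure dot c -> spin_structure dot c' ->
  (forall n, (0 < n < (2 * g).+1)%N -> c (gammaN n) = c' (gammaN n)) -> c = c'.
Proof.
move=> cP c'P cc'; pose d x : 'F_2 := c x + c' x.
suff d0 : forall x, d x = 0 by apply/ffunP=> x; apply: addF2_eq0; apply: d0.
have dD x y : d (x + y) = d x + d y.
  by rewrite /d cP c'P addrACA addF2 addr0 addrACA.
have d00 : d 0 = 0 by rewrite /d (spin0 cP) (spin0 c'P) addr0.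
have dZ a x : d (a *: x) = a * d x.
  by have [->|->] := F2_cases a; rewrite ?scale0r ?mul0r // scale1r mul1r.
have dgamma n : (0 < n < (2 * g).+1)%N -> d (gammaN n) = 0.
  by move=> /cc' E; rewrite /d E addF2.
have dalpha i : d (alpha i) = 0.
  by rewrite -alphaN_ord -gammaN_even dgamma //; have := ltn_ord i; lia.
(* The vectors of odd index are sums of consecutive [betaN], so the vanishing propagates from
   [betaN 0 = 0]. *)
have dbetaN n : (n <= g)%N -> d (betaN n) = 0.
  elim: n => [|n IH] ng //; have := dgamma (2 * n).+1.
  by rewrite gammaN_odd dD IH ?add0r; [apply|]; lia.
have dbeta i : d (beta i) = 0 by rewrite -betaN_ord dbetaN.
move=> x; rewrite (coord_basis (X := in_tuple _) (alpha_beta_basis symp) (memvf x)).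
rewrite (big_morph d dD d00) big1 // => i _; rewrite dZ.
have : (codom alpha ++ codom beta)`_i \in codom alpha ++ codom beta.
  exact: mem_nth.
rewrite mem_cat => /orP[] /codomP[j ->]; by rewrite ?dalpha ?dbeta mulr0.
Qed.

(** * The action through [iota] *)

Section Iota.

Variable iota : {morphism [set: 'S_(2 * g).+2] >-> {perm H1 g}}.
Hypotheses (iotaP : is_iota dot alpha beta iota) (g_gt0 : (0 < g)%N).
Local Notation N := (2 * g).+2.

Lemma iota_sigma n : (0 < n < N)%N ->
  iota (sigma g n) =1 transvection dot (gammaN n).
Proof.
move=> nP x; have := odd_double_half n; case: (odd n) => nE.
  have {nE} nE : n = (2 * n./2).+1 by lia.
  rewrite nE gammaN_odd; set m := n./2 in nE *.
  case m0 : m => [|i].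
    rewrite (iota_first iotaP (i := Ordinal g_gt0)) // add0r.
    by rewrite (betaN_ord (Ordinal g_gt0)).
  have ig : (i < g)%N by lia.
  have [ig'|gi] := ltnP i.+1 g.
    rewrite (betaN_ord (Ordinal ig)) (betaN_ord (Ordinal ig')).
    by rewrite -(@iota_odd _ _ _ _ _ iotaP (Ordinal ig) (Ordinal ig')) // addn1.
  have {gi} gi : i.+1 = g by lia.
  rewrite (betaN_ord (Ordinal ig)) [i.+2](congr1 S gi) betaN_big addr0.
  by rewrite -(@iota_last _ _ _ _ _ iotaP (Ordinal ig)) // addn1 gi.
have {nE} -> : n = (2 * n./2.-1.+1)%N by lia.
have ng : (n./2.-1 < g)%N by lia.
by rewrite gammaN_even (alphaN_ord (Ordinal ng)) -(iota_even iotaP).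
Qed.

Lemma iota_add s x y : iota s (x + y) = iota s x + iota s y.
Proof.
have /subsetP/(_ (iota s)) := iota_Sp iotaP.
rewrite mem_morphim ?inE // => /(_ isT) /forallP/(_ x)/forallP/(_ y).
by case/andP=> /eqP.
Qed.

Lemma iota_dot s x y : dot (iota s x) (iota s y) = dot x y.
Proof.
have /subsetP/(_ (iota s)) := iota_Sp iotaP.
rewrite mem_morphim ?inE // => /(_ isT) /forallP/(_ x)/forallP/(_ y).
by case/andP=> _ /eqP.
Qed.

Lemma spin_act_spin c s : spin_structure dot c ->
  spin_structure dot (spin_act iota c s).
Proof. by move=> cP x y; rewrite !ffunE iota_add cP iota_dot. Qed.

(* Conjugation by [iota tau] turns the transvection along [gammaN n] into the
   one along its image, and over F_2 a transvection determines its vector. *)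
Lemma iota_tau n : (0 < n < N)%N ->
  iota (tau g) (gammaN n) = gammaN (N - n).
Proof.
move=> nP; have [x x1] := dot_gammaN nP g_gt0.
have nP' : (0 < N - n < N)%N by lia.
(* At the image of [x], the conjugation identity says that [iota (tau g)] sends [gammaN n] to a
   scalar multiple of [gammaN (N - n)]. *)
have := permJ (iota (sigma g n)) (iota (tau g)) x.
rewrite -morphJ ?inE // sigmaJ_tau // !iota_sigma // /transvection x1 scale1r.
rewrite iota_add => /addrI; have := iota_dot (tau g) x (gammaN n).
(* A zero scalar would send [gammaN n] to 0, against the invariance of [dot x (gammaN n) = 1]. *)
case: (F2_cases (dot (iota (tau g) x) (gammaN (N - n)))) => -> + E; rewrite -E.
  by rewrite scale0r linear0r x1 => /eqP; rewrite eq_sym oner_eq0.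
by rewrite scale1r.
Qed.

(** With a group structure on the stabilizer, inclusion of a generated subgroup can be checked on
    generators. *)
Lemma isotropy_group_set c : group_set (isotropy iota c).
Proof.
apply/group_setP; split=> [|s t]; rewrite !inE.
  by apply/eqP/ffunP=> x; rewrite !ffunE morph1 perm1.
move=> /eqP/ffunP sP /eqP/ffunP tP; apply/eqP/ffunP=> x.
by have := tP (iota s x); have := sP x; rewrite !ffunE morphM ?inE // permM => -> ->.
Qed.

Canonical isotropy_group c := Group (isotropy_group_set c).

End Iota.

End SpinStructures.

(** * Isotropy of the spin structures with matrix [Mbar] *)

Section MbarSpin.

Variables (k g m : nat).
Hypotheses (k_ge1 : (1 <= k)%N) (m_le : (m <= (g + 1) %/ 2)%N).
Hypothesis g_eq : g = (4 * k - 1)%N \/ g = (4 * k + 1)%N.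
Variables (dot : {biscalar H1 g}) (alpha beta : 'I_g -> H1 g).
Hypothesis symp : symplectic_basis dot alpha beta.
Variable c : {ffun H1 g -> 'F_2}.
Hypotheses (cP : spin_structure dot c)
  (cM : spin_matrix alpha beta c = Mbar k g m).

(** For odd [n], exactly one of two consecutive orthogonal [betaN] has value 1. For even [n], the
    exceptional [alpha] has index [(g + 1) / 2 + m], half of [g + 1 + 2 * m]. *)
Lemma Mbar_spin_gammaN n : (0 < n < (2 * g).+2)%N ->
  c (gammaN alpha beta n) = (n != g + 1 + 2 * m)%N%:R.
Proof.
have calpha i : c (alpha i) = (i.+1 != (g + 1) %/ 2 + m)%N%:R.
  have := congr1 (fun M : 'M_(2, g) => M 0 i) cM.
  by rewrite /= mxE MbarE.
have cbeta i : c (beta i) = (~~ odd i)%:R.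
  have := congr1 (fun M : 'M_(2, g) => M 1 i) cM.
  by rewrite /= mxE /= MbarE.
have cbetaN j : (j <= g.+1)%N -> c (betaN beta j) = (odd j)%:R.
  case: j => [|j] jg; first by rewrite (spin0 symp cP).
  have [{}jg|gj] := ltnP j g; first by rewrite (betaN_ord _ (Ordinal jg)) cbeta.
  (* The value at [betaN g.+1 = 0] still fits the parity formula because [g] is odd. *)
  have -> : j = g by lia.
  rewrite betaN_big (spin0 symp cP) /=.
  by have -> : odd g by lia.
have dot_betaN i j : dot (betaN beta i) (betaN beta j) = 0.
  case: i => [|i] /=; first exact: linear0l.
  case: j => [|j] /=; first exact: linear0r.
  case: insubP => [u _ _|_] /=; last exact: linear0l.
  case: insubP => [v _ _|_] /=; last exact: linear0r.
  exact: dot_beta_beta symp _ _.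
move=> nP; have := odd_double_half n; case: (odd n) => nE.
  have -> : n = (2 * n./2).+1 by lia.
  rewrite gammaN_odd cP dot_betaN addr0 !cbetaN /=; try lia.
  have -> : ((2 * n./2).+1 != g + 1 + 2 * m)%N by lia.
  by case: (odd n./2); rewrite ?addr0 ?add0r.
have -> : n = (2 * n./2.-1.+1)%N by lia.
have ng : (n./2.-1 < g)%N by lia.
rewrite gammaN_even (alphaN_ord _ (Ordinal ng)) calpha /=.
by congr (nat_of_bool _)%:R; lia.
Qed.

Variable iota : {morphism [set: 'S_(2 * g).+2] >-> {perm H1 g}}.
Hypothesis iotaP : is_iota dot alpha beta iota.

Lemma sigma_isotropy n : (0 < n < (2 * g).+2)%N -> n != (g + 1 + 2 * m)%N ->
  sigma g n \in isotropy iota c.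
Proof.
move=> nP nm; rewrite inE; apply/eqP/ffunP=> x; rewrite ffunE.
rewrite (iota_sigma iotaP) //; last lia.
by rewrite (spin_transvection symp) // Mbar_spin_gammaN // nm.
Qed.

(** For [m = 0] the exceptional index [g + 1] is the fixed point of the exchange of [n] and
    [2g + 2 - n], so the values on all [gammaN] are preserved. *)
Lemma tau_isotropy : m = 0%N -> tau g \in isotropy iota c.
Proof.
move=> m0; have g0 : (0 < g)%N by lia.
rewrite inE; apply/eqP; apply: (spin_ext symp) => //.
  exact: (spin_act_spin iotaP).
move=> n nP; rewrite ffunE (iota_tau symp iotaP) ?Mbar_spin_gammaN //; try lia.
by congr (nat_of_bool _)%:R; lia.
Qed.

Lemma sigmas_but_isotropy :
  sigmas_but g (g + 1 + 2 * m) \subset isotropy iota c.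
Proof.
apply/subsetP=> s /imsetP[i]; rewrite inE => /andP[i0 im] ->.
by apply: sigma_isotropy => //; rewrite i0 ltn_ord.
Qed.

End MbarSpin.

Theorem theorem4p4 (k g : nat) (k_ge1 : (1 <= k)%N)
    (g_eq : g = (4 * k - 1)%N \/ g = (4 * k + 1)%N)
    (dot : {biscalar H1 g}) (alpha beta : 'I_g -> H1 g)
    (symp : symplectic_basis dot alpha beta)
    (iota : {morphism [set: 'S_(2 * g).+2] >-> {perm H1 g}})
    (iotaP : is_iota dot alpha beta iota) :
  (forall m : nat, (1 <= m <= (g + 1) %/ 2)%N ->
     (GG g m \isog setX [set: 'S_(g + 1 + 2 * m)] [set: 'S_(g + 1 - 2 * m)])%g
     /\
     (forall c : {ffun H1 g -> 'F_2},
        spin_structure dot c -> spin_matrix alpha beta c = Mbar k g m ->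
        GG g m \subset isotropy iota c))
  /\
  (forall c : {ffun H1 g -> 'F_2},
     spin_structure dot c -> spin_matrix alpha beta c = Mbar k g 0 ->
     GG0 g \subset isotropy iota c).
Proof.
split=> [m /andP[m1 mg]|c cP cM].
  split=> [|c cP cM]; first by apply: GG_isog; lia.
  by rewrite gen_subG; apply: (@sigmas_but_isotropy k) symp _ cP cM _ iotaP.
rewrite gen_subG subUset sub1set (tau_isotropy _ _ g_eq symp cP cM) //=.
by have := sigmas_but_isotropy k_ge1 (leq0n _) g_eq symp cP cM iotaP; rewrite addn0.
Qed.
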